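(* Let $A\in\mathbb{R}^{n\times n}$ be symmetric positive definite, $b\in\mathbb{R}^n$, $x^\ast=A^{-1}b$, $k\in\{1,\dots,n-1\}$ and $\theta>0$. Let $\hat x_\ell(\theta)$ be the $\ell$-th iterate of the preconditioned conjugate gradient method when solving $Ax=b$ with preconditioner $F_\theta$ started from an arbitrary initial guess $x_0\in\mathbb{R}^n$. Let $x_\ell^{\mathrm{Def}}$ be the $\ell$-th iterate generated by the conjugate gradient method when solving $Ax=b$ started from $x_0^{\mathrm{Def}}=x_0+S_k\Lambda_k^{-1}S_k^\top(b-Ax_0)$. Then, in exact arithmetic, for every $\ell\ge0$, $$\|x^\ast-x_{\ell+1}^{\mathrm{Def}}\|_A\le\|x^\ast-\hat x_{\ell+1}(\theta)\|_A\le\frac{\alpha(\theta)}{\theta}\,\|x^\ast-x_\ell^{\mathrm{Def}}\|_A,$$ with $\alpha(\theta)=\max\left(|\lambda_{k+1}-\theta|,\ |\theta-\lambda_n|\right)$.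
   Context: Notation: $A=S\Lambda S^\top$ is the spectral decomposition, with $\Lambda=\mathrm{diag}(\lambda_1,\dots,\lambda_n)$, $\lambda_1\ge\cdots\ge\lambda_n>0$, and $S=[s_1\ \cdots\ s_n]$ orthogonal. $S_k=[s_1\ \cdots\ s_k]$, $\Lambda_k=\mathrm{diag}(\lambda_1,\dots,\lambda_k)$. $\|x\|_A=\sqrt{x^\top Ax}$. Scaled spectral preconditioner: $F_\theta=I_n+\sum_{i=1}^k\left(\frac{\theta}{\lambda_i}-1\right)s_is_i^\top$. Preconditioned conjugate gradient method (PCG) with preconditioner $F$ and initial guess $\hat x_0$: $\hat r_0=b-A\hat x_0$, $z_0=F\hat r_0$, $\hat\rho_0=\hat r_0^\top z_0$, $\hat p_0=z_0$, and for $\ell=0,1,\dots$: $\hat q_\ell=A\hat p_\ell$, $\hat\alpha_\ell=\hat\rho_\ell/(\hat q_\ell^\top\hat p_\ell)$, $\hat x_{\ell+1}=\hat x_\ell+\hat\alpha_\ell\hat p_\ell$, $\hat r_{\ell+1}=\hat r_\ell-\hat\alpha_\ell\hat q_\ell$, $z_{\ell+1}=F\hat r_{\ell+1}$, $\hat\rho_{\ell+1}=\hat r_{\ell+1}^\top z_{\ell+1}$, $\hat\beta_{\ell+1}=\hat\rho_{\ell+1}/\hat\rho_\ell$, $\hat p_{\ell+1}=z_{\ell+1}+\hat\beta_{\ell+1}\hat p_\ell$. The conjugate gradient method (CG) is the case $F=I_n$. If the residual at step $\ell$ is zero the method has terminated with the exact solution $x^\ast$, and later iterates are taken equal to $x^\ast$.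 *)

(* Defs.v *)
From HB Require Import structures.
From mathcomp Require Import all_boot all_order all_algebra.
Set Implicit Arguments.
Unset Strict Implicit.
Unset Printing Implicit Defensive.
Import Order.TTheory GRing.Theory Num.Theory.
Local Open Scope ring_scope.

Definition dotc (R : rcfType) (n : nat) (u v : 'cV[R]_n) : R := (u^T *m v) 0 0.

Definition normA (R : rcfType) (n : nat) (A : 'M[R]_n) (x : 'cV[R]_n) : R :=
  Num.sqrt (dotc x (A *m x)).

Definition spd (R : rcfType) (n : nat) (A : 'M[R]_n) : Prop :=
  A^T = A /\ forall x : 'cV[R]_n, x != 0 -> 0 < dotc x (A *m x).

(* Indices start at 0: the i-th largest eigenvalue and its eigenvector are
   [lam 0 j] and [col j S] for the ordinal j of value i - 1. *)
Definition spectral_decomposition (R : rcfType) (n : nat)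
    (A S : 'M[R]_n) (lam : 'rV[R]_n) : Prop :=
  [/\ S^T *m S = 1%:M,
      A = S *m diag_mx lam *m S^T,
      forall i j : 'I_n, (i <= j)%N -> lam 0 j <= lam 0 i
    & forall i : 'I_n, 0 < lam 0 i].

Definition scaled_spectral_precond (R : rcfType) (n : nat)
    (S : 'M[R]_n) (lam : 'rV[R]_n) (k : nat) (theta : R) : 'M[R]_n :=
  1%:M + \sum_(i < n | (i < k)%N)
           (theta / lam 0 i - 1) *: (col i S *m (col i S)^T).

Definition ord_first (n : nat) (k : 'I_n) : 'I_k -> 'I_n :=
  widen_ord (ltnW (ltn_ord k)).

Definition lead_vecs (R : rcfType) (n : nat) (S : 'M[R]_n) (k : 'I_n)
  : 'M[R]_(n, k) := colsub (@ord_first n k) S.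

Definition lead_diag (R : rcfType) (n : nat) (lam : 'rV[R]_n) (k : 'I_n)
  : 'M[R]_k := diag_mx (colsub (@ord_first n k) lam).

Definition deflated_guess (R : rcfType) (n : nat) (A S : 'M[R]_n)
    (lam : 'rV[R]_n) (k : 'I_n) (b x0 : 'cV[R]_n) : 'cV[R]_n :=
  x0 + lead_vecs S k *m invmx (lead_diag lam k) *m (lead_vecs S k)^T
         *m (b - A *m x0).

Record pcg_state (R : rcfType) (n : nat) := PCGState {
  pcg_x : 'cV[R]_n;
  pcg_r : 'cV[R]_n;
  pcg_rho : R;
  pcg_p : 'cV[R]_n }.

Definition pcg_init (R : rcfType) (n : nat) (A F : 'M[R]_n) (b x0 : 'cV[R]_n)
  : pcg_state R n :=
  let r := b - A *m x0 in
  let z := F *m r in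
  PCGState x0 r (dotc r z) z.

(* A zero residual means that the current iterate is the exact solution; the
   state is then frozen, so all later iterates are that solution. *)
Definition pcg_step (R : rcfType) (n : nat) (A F : 'M[R]_n)
    (st : pcg_state R n) : pcg_state R n :=
  let: PCGState x r rho p := st in
  if r == 0 then st else
  let q := A *m p in
  let alpha := rho / dotc q p in
  let x' := x + alpha *: p in
  let r' := r - alpha *: q in
  let z' := F *m r' in
  let rho' := dotc r' z' in
  let beta := rho' / rho in
  PCGState x' r' rho' (z' + beta *: p).

Definition pcg_iterate (R : rcfType) (n : nat) (A F : 'M[R]_n)
    (b x0 : 'cV[R]_n) (l : nat) : 'cV[R]_n :=
  pcg_x (iter l (pcg_step A F) (pcg_init A F b x0)).

Definition cg_iterate (R : rcfType) (n : nat) (A : 'M[R]_n)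
    (b x0 : 'cV[R]_n) (l : nat) : 'cV[R]_n :=
  pcg_iterate A 1%:M b x0 l.

(* Main.v *)
Require Import Defs.
From HB Require Import structures.
From mathcomp Require Import all_boot all_order all_algebra.
From mathcomp Require Import ring.
Set Implicit Arguments.
Unset Strict Implicit.
Unset Printing Implicit Defensive.
Import Order.TTheory GRing.Theory Num.Theory.
Local Open Scope ring_scope.

(** Everything rests on the classical optimality of the preconditioned
    conjugate gradient method: the error after l steps has the form
    P(FA) e0, with P(0) = 1 and deg P <= l, and no polynomial subject to these
    constraints gives a smaller energy norm ([pcg_iterate_optimal]).

    In the eigenbasis S both methods then become scalar. The matrix F_theta A
    is diagonal with entries mu_i, where mu_i = theta for i < k and
    mu_i = lam_i for i >= k, while deflating the initial guess erases
    the first k coordinates of e0 and changes nothing else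
    ([deflated_guess_error]). With y the coordinates of e0, the squared energy
    norms of the errors that P produces are
      sum_i lam_i P(mu_i)^2 y_i^2            for the preconditioned run,
      sum_(i >= k) lam_i P(lam_i)^2 y_i^2    for the deflated run.

    Left inequality: the polynomial of the preconditioned run, used in the
    deflated run at the same step, drops the first k terms of the sum and keeps
    the others; optimality of the deflated run concludes.

    Right inequality: let P be the polynomial of the deflated run at step l and
    Q = P (1 - X / theta), which is admissible for the preconditioned run at
    step l + 1. The new factor vanishes at theta, which kills the first k
    terms, and it is at most alpha / theta in absolute value at the remaining
    eigenvalues, which all lie between lam 0 ord_max and lam 0 k. Optimality of
    the preconditioned run concludes. Termwise comparisons of such sums are the
    object of [normA_spectral_le]. *)

(** * The bilinear form and the energy *)

Lemma dotcC (R : rcfType) n (u v : 'cV[R]_n) : dotc u v = dotc v u.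
Proof. by rewrite /dotc !mxE; apply: eq_bigr => i _; rewrite !mxE mulrC. Qed.

Lemma dotcDl (R : rcfType) n (u v w : 'cV[R]_n) :
  dotc (u + v) w = dotc u w + dotc v w.
Proof. by rewrite /dotc linearD mulmxDl mxE. Qed.

Lemma dotcZl (R : rcfType) n a (u w : 'cV[R]_n) : dotc (a *: u) w = a * dotc u w.
Proof. by rewrite /dotc linearZ -scalemxAl mxE. Qed.

Lemma dotcBl (R : rcfType) n (u v w : 'cV[R]_n) :
  dotc (u - v) w = dotc u w - dotc v w.
Proof. by rewrite -scaleN1r dotcDl dotcZl mulN1r. Qed.

Lemma dotcDr (R : rcfType) n (u v w : 'cV[R]_n) :
  dotc w (u + v) = dotc w u + dotc w v.
Proof. by rewrite ![dotc w _]dotcC dotcDl. Qed.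

Lemma dotcBr (R : rcfType) n (u v w : 'cV[R]_n) :
  dotc w (u - v) = dotc w u - dotc w v.
Proof. by rewrite ![dotc w _]dotcC dotcBl. Qed.

Lemma dotcZr (R : rcfType) n a (u w : 'cV[R]_n) : dotc w (a *: u) = a * dotc w u.
Proof. by rewrite ![dotc w _]dotcC dotcZl. Qed.

Lemma dotc0l (R : rcfType) n (u : 'cV[R]_n) : dotc 0 u = 0.
Proof. by rewrite -[0](scale0r u) dotcZl mul0r. Qed.

Lemma dotc_mull (R : rcfType) n (M : 'M[R]_n) (u v : 'cV[R]_n) :
  M^T = M -> dotc (M *m u) v = dotc u (M *m v).
Proof. by move=> hM; rewrite /dotc trmx_mul hM mulmxA. Qed.

Lemma spd_dotc_gt0 (R : rcfType) n (A : 'M[R]_n) (x : 'cV[R]_n) :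
  spd A -> x != 0 -> 0 < dotc x (A *m x).
Proof. by case=> _; apply. Qed.

Lemma spd_dotc_ge0 (R : rcfType) n (A : 'M[R]_n) (x : 'cV[R]_n) :
  spd A -> 0 <= dotc x (A *m x).
Proof.
move=> hA; have [->|x0] := eqVneq x 0; first by rewrite dotc0l.
exact/ltW/spd_dotc_gt0.
Qed.

(** * Krylov spaces *)

Lemma poly_split0 (R : rcfType) (p : {poly R}) d : (size p <= d.+1)%N ->
  exists2 q : {poly R}, (size q <= d)%N & p = q * 'X + p.[0]%:P.
Proof.
move=> sp; exists (drop_poly 1 p); first by rewrite size_drop_poly leq_subLR.
rewrite -{1}[p](poly_take_drop 1) addrC expr1; congr (_ + _).
by apply/polyP => i; rewrite coef_take_poly coefC horner_coef0; case: i.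
Qed.

Lemma horner_mx_mulC (R : rcfType) n (M : 'M[R]_n.+1) (p : {poly R}) :
  M *m horner_mx M p = horner_mx M p *m M.
Proof. by have := comm_horner_mx2 M 'X p; rewrite horner_mx_X. Qed.

(** Members are described by polynomials rather than as a span, because the
    residual polynomials are what the two methods have in common. *)
Definition krylov (R : rcfType) n (M : 'M[R]_n.+1) (z : 'cV[R]_n.+1) d v :=
  exists2 D : {poly R}, (size D <= d)%N & v = horner_mx M D *m z.

Lemma krylovS (R : rcfType) n (M : 'M[R]_n.+1) z d v :
  krylov M z d v -> krylov M z d.+1 v.
Proof. by case=> D sD ->; exists D => //; apply: leqW. Qed.

Lemma krylovD (R : rcfType) n (M : 'M[R]_n.+1) z d u v :
  krylov M z d u -> krylov M z d v -> krylov M z d (u + v).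
Proof.
move=> [D sD ->] [E sE ->]; exists (D + E); last by rewrite rmorphD mulmxDl.
by rewrite (leq_trans (size_polyD _ _)) // geq_max sD.
Qed.

Lemma krylovZ (R : rcfType) n (M : 'M[R]_n.+1) z d a v :
  krylov M z d v -> krylov M z d (a *: v).
Proof.
move=> [D sD ->]; exists (a *: D); last by rewrite linearZ scalemxAl.
by rewrite (leq_trans (size_scale_leq _ _)).
Qed.

Lemma krylov_mul (R : rcfType) n (M : 'M[R]_n.+1) z d v :
  krylov M z d v -> krylov M z d.+1 (M *m v).
Proof.
move=> [D sD ->]; exists ('X * D); last by rewrite rmorphM /= horner_mx_X mulmxA.
have [->|D0] := eqVneq D 0; first by rewrite mulr0 size_poly0.
by rewrite mulrC size_mulX.
Qed.

Lemma krylov_base (R : rcfType) n (M : 'M[R]_n.+1) z d : krylov M z d.+1 z.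
Proof. by exists 1; rewrite ?size_poly1 // rmorph1 mul1mx. Qed.

Lemma krylov_split (R : rcfType) n (M : 'M[R]_n.+1) z d v :
  krylov M z d.+1 v ->
  exists c w, krylov M z d w /\ v = c *: z + M *m w.
Proof.
case=> D sD ->; have [q sq {1}->] := poly_split0 sD.
exists D.[0], (horner_mx M q *m z); split; first by exists q.
rewrite addrC rmorphD rmorphM /= horner_mx_C horner_mx_X mulmxDl mul_scalar_mx.
by rewrite mulmxA horner_mx_mulC.
Qed.

(** The difference of two polynomials with the same value at 0 is divisible by
    X: this is why the relevant Krylov space is generated by M e0, not e0. *)
Lemma residual_poly_diff (R : rcfType) n (M : 'M[R]_n.+1) e0 d (P Q : {poly R}) :
  (size P <= d.+1)%N -> (size Q <= d.+1)%N -> P.[0] = Q.[0] ->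
  krylov M (M *m e0) d (horner_mx M Q *m e0 - horner_mx M P *m e0).
Proof.
move=> sP sQ h; have sB : (size (Q - P)%R <= d.+1)%N.
  by rewrite (leq_trans (size_polyD _ _)) // geq_max sQ size_polyN.
have [q sq eq] := poly_split0 sB; exists q => //.
rewrite -mulmxBl -rmorphB eq hornerD hornerN h subrr addr0 rmorphM /= horner_mx_X.
by rewrite mulmxA.
Qed.

(** * Optimality of the preconditioned conjugate gradient iterates *)

(** What holds as long as the method has not terminated. With K_l the
    Krylov space spanned by (FA)^j FA e0 for j < l, the last clause says that K_(l+1) = K_l + <p_l>: this
    lets orthogonality to K_l and to p_l be checked separately, and avoids any
    discussion of the degrees of the direction polynomials. *)
Record pcg_directions (R : rcfType) n (A F : 'M[R]_n.+1) (e0 : 'cV[R]_n.+1) l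
    (st : pcg_state R n.+1) : Prop := PCGDirections {
  pcgd_rho : pcg_rho st = dotc (pcg_r st) (F *m pcg_r st);
  pcgd_mem : krylov (F *m A) (F *m A *m e0) l.+1 (pcg_p st);
  pcgd_dot : dotc (pcg_p st) (pcg_r st) = pcg_rho st;
  pcgd_orth : forall v, krylov (F *m A) (F *m A *m e0) l v ->
    dotc v (pcg_r st) = 0;
  pcgd_conj : forall v, krylov (F *m A) (F *m A *m e0) l v ->
    dotc v (A *m pcg_p st) = 0;
  pcgd_span : forall v, krylov (F *m A) (F *m A *m e0) l.+1 v ->
    exists a, krylov (F *m A) (F *m A *m e0) l (v - a *: pcg_p st) }.

(** Once the residual vanishes the state stops moving: the first two clauses
    remain true, the direction data does not. *)
Record pcg_invariant (R : rcfType) n (A F : 'M[R]_n.+1) (xs x0 : 'cV[R]_n.+1) l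
    (st : pcg_state R n.+1) : Prop := PCGInvariant {
  pcgi_res : pcg_r st = A *m (xs - pcg_x st);
  pcgi_poly : exists P : {poly R}, [/\ (size P <= l.+1)%N, P.[0] = 1
    & xs - pcg_x st = horner_mx (F *m A) P *m (xs - x0)];
  pcgi_dirs : pcg_r st != 0 -> pcg_directions A F (xs - x0) l st }.

Lemma pcg_invariant_init (R : rcfType) n (A F : 'M[R]_n.+1) (xs x0 : 'cV[R]_n.+1) :
  pcg_invariant A F xs x0 0 (pcg_init A F (A *m xs) x0).
Proof.
have rE : A *m xs - A *m x0 = A *m (xs - x0) by rewrite mulmxBr.
have K0 v : krylov (F *m A) (F *m A *m (xs - x0)) 0 v -> v = 0.
  by case=> D; rewrite size_poly_leq0 => /eqP-> ->; rewrite rmorph0 mul0mx.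
split=> [//||_].
  by exists 1; rewrite size_poly1 hornerC rmorph1 mul1mx.
split=> /=; rewrite ?rE ?mulmxA //.
- exact: krylov_base.
- by rewrite dotcC.
- by move=> v /K0->; rewrite dotc0l.
- by move=> v /K0->; rewrite dotc0l.
- move=> v /krylov_split[c [w [/K0-> ->]]]; exists c.
  by rewrite mulmx0 addr0 subrr; exists 0; rewrite ?size_poly0 // rmorph0 mul0mx.
Qed.

(** Orthogonality of the new residual to p_l is the choice of the step length,
    conjugacy of p_(l+1) and p_l is the choice of beta, and conjugacy to the
    older directions comes from symmetry: the F-image of A v, for v in K_l, is
    again in K_(l+1), to which the new residual is orthogonal. *)
Lemma pcg_invariant_step (R : rcfType) n (A F : 'M[R]_n.+1) (xs x0 : 'cV[R]_n.+1)
    l st : spd A -> spd F ->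
  pcg_invariant A F xs x0 l st ->
  pcg_invariant A F xs x0 l.+1 (pcg_step A F st).
Proof.
move=> hA hF [hr [P [sP P0 eP]] hd]; rewrite /pcg_step.
case: st hr eP hd => x r rho p /= hr eP hd.
have [r0|rn0] := eqVneq r 0.
  by split=> //=; [exists P; rewrite (leqW sP) | rewrite r0 eqxx].
set e0 := xs - x0 in eP hd *; set M := F *m A in eP hd *.
case: (hd rn0) => /= hrho hpK hpr hor hcj hsp.
set K := krylov M (M *m e0) in hpK hor hcj hsp.
have [As Fs] : A^T = A /\ F^T = F by case: hA hF => ? _ [].
have rho0 : rho != 0 by rewrite hrho gt_eqF // spd_dotc_gt0.
have pn0 : p != 0 by apply: contra_neq rho0 => p0; rewrite -hpr p0 dotc0l.
have d0 : dotc (A *m p) p != 0 by rewrite dotcC gt_eqF // spd_dotc_gt0.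
set a := rho / _; set r' := r - _; set x' := x + _; set z' := F *m r'.
set rho' := dotc r' z'; set b := rho' / rho; set p' := z' + _.
have a0 : a != 0 by rewrite mulf_neq0 ?invr_eq0.
have ad : a * dotc (A *m p) p = rho by rewrite divfK.
have er : r' = A *m (xs - x').
  by rewrite /x' opprD addrA mulmxBr -hr -scalemxAr.
have [P' [sP' P'0 eP']] : exists P' : {poly R},
    [/\ (size P' <= l.+2)%N, P'.[0] = 1 & xs - x' = horner_mx M P' *m e0].
  have [D sD eD] := hpK.
  exists (P - a *: D * 'X); split.
  - rewrite (leq_trans (size_polyD _ _)) // geq_max (leqW sP) size_polyN.
    have [->|D0] := eqVneq (a *: D) 0; first by rewrite mul0r size_poly0.
    by rewrite size_mulX // ltnS (leq_trans (size_scale_leq _ _)).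
  - by rewrite hornerD hornerN hornerMX mulr0 subr0.
  - rewrite rmorphB /= mulmxBl -eP rmorphM /= horner_mx_X linearZ /= -mulmxE.
    by rewrite -mulmxA -scalemxAl -eD /x' opprD addrA.
have zP (Q : {poly R}) e d : (size Q <= d)%N -> e = horner_mx M Q *m e0 ->
    K d (F *m (A *m e)).
  by move=> sQ ->; exists Q => //; rewrite [LHS]mulmxA mulmxA horner_mx_mulC -mulmxA.
have zK : K l.+1 (F *m r) by rewrite hr; apply: zP eP.
have z'K : K l.+2 z' by rewrite /z' er; apply: zP eP'.
have p'K : K l.+2 p' by apply/krylovD/krylovZ/krylovS.
have span v : K l.+1 v -> exists c w, K l w /\ v = w + c *: p.
  by move=> /hsp[c hc]; exists c, (v - c *: p); rewrite subrK.
have orth v : K l.+1 v -> dotc v r' = 0.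
  move=> /span[c [w [hw ->]]]; rewrite dotcDl dotcZl !dotcBr !dotcZr.
  rewrite hor // hcj // mulr0 subr0 add0r hpr [dotc p _]dotcC ad subrr.
  by rewrite mulr0.
(* The residual update read backwards: this is how FA acts on the newest
   direction, both for conjugacy and for the span of the next space. *)
have FAp : F *m (A *m p) = a^-1 *: (F *m r - z').
  by rewrite /z' mulmxBr opprB addrC subrK -scalemxAr scalerA mulVf ?scale1r.
split=> [//||_]; first by exists P'.
split=> //=.
- by rewrite /p' dotcDl dotcZl (orth p) // mulr0 addr0 dotcC.
- have zA u : dotc u (A *m p') = dotc (F *m (A *m u)) r' + b * dotc u (A *m p).
    rewrite /p' mulmxDr -scalemxAr dotcDr dotcZr; congr (_ + _).
    by rewrite -(dotc_mull u z' As) /z' (dotc_mull _ _ Fs).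
  move=> v /span[c [w [hw ->]]]; rewrite dotcDl dotcZl !zA.
  rewrite [dotc _ r']orth; last by rewrite mulmxA; apply: krylov_mul.
  rewrite hcj // FAp dotcZl dotcBl orth // [dotc z' _]dotcC -/rho'.
  by rewrite /b -ad [dotc p _]dotcC; field; rewrite a0 d0.
- move=> v /krylov_split[c [w [/span[f [w' [hw' ->]]] ->]]].
  (* w = w' + f p_l and FA p_l = (z_l - z_(l+1)) / a, so the component of v
     along the new direction is - f / a. *)
  exists (- (f / a)).
  rewrite -/M -/e0 -/K [M *m (w' + _)]mulmxDr -scalemxAr -[M *m p]mulmxA FAp.
  have -> : c *: (M *m e0) + (M *m w' + f *: (a^-1 *: (F *m r - z')))
      - - (f / a) *: p' = c *: (M *m e0) + M *m w' + (f / a) *: (F *m r)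
        + (f / a * b) *: p.
    rewrite scaleNr opprK scalerA -!addrA; congr (_ + (_ + _)).
    by rewrite -scalerDr /p' addrA subrK scalerDr scalerA.
  do 2?apply: krylovD; try exact: krylovZ.
  + by apply/krylovD/krylov_mul => //; apply/krylovZ/krylov_base.
Qed.

(** Pythagoras in the energy inner product. *)
Lemma energy_le_conj (R : rcfType) n (A : 'M[R]_n) (e v : 'cV[R]_n) : spd A ->
  dotc v (A *m e) = 0 -> dotc e (A *m e) <= dotc (e + v) (A *m (e + v)).
Proof.
move=> hA ve; have As : A^T = A by case: hA.
rewrite mulmxDr !dotcDl !dotcDr ve -(dotc_mull e v As) [dotc (A *m e) _]dotcC ve.
by rewrite addr0 add0r lerDl spd_dotc_ge0.
Qed.

(** A competitor differs from the error by a vector of K_l, and K_l is orthogonal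
    to the residual A e: the minimum is attained by Pythagoras. Once the
    residual is zero the orthogonality is trivial. *)
Lemma pcg_iterate_optimal (R : rcfType) n (A F : 'M[R]_n.+1)
    (xs x0 : 'cV[R]_n.+1) l : spd A -> spd F ->
  let e := xs - pcg_iterate A F (A *m xs) x0 l in
  exists P : {poly R}, [/\ (size P <= l.+1)%N, P.[0] = 1,
    e = horner_mx (F *m A) P *m (xs - x0)
    & forall Q : {poly R}, (size Q <= l.+1)%N -> Q.[0] = 1 ->
      normA A e <= normA A (horner_mx (F *m A) Q *m (xs - x0))].
Proof.
move=> hA hF e.
have inv : pcg_invariant A F xs x0 l
    (iter l (pcg_step A F) (pcg_init A F (A *m xs) x0)).
  elim: l {e} => [|l IHl]; first exact: pcg_invariant_init.
  exact: pcg_invariant_step.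
have [P [sP P0 eP]] := pcgi_poly inv; exists P; split=> // Q sQ Q0.
rewrite /normA ler_wsqrtr //.
set g := horner_mx _ Q *m _; pose v := g - e.
have vr : dotc v (A *m e) = 0.
  have [r0|rn0] := eqVneq (pcg_r (iter l (pcg_step A F)
      (pcg_init A F (A *m xs) x0))) 0.
    by rewrite -(pcgi_res inv) r0 dotcC dotc0l.
  rewrite -(pcgi_res inv); apply: (pcgd_orth (pcgi_dirs inv rn0)).
  by rewrite /v /e /pcg_iterate eP; apply: residual_poly_diff; rewrite // P0 Q0.
have -> : g = e + v by rewrite addrC subrK.
exact: energy_le_conj.
Qed.

(** * Matrices that are diagonal in a fixed orthonormal basis *)

Definition spectral_mx (R : rcfType) n (S : 'M[R]_n) (d : 'I_n -> R) : 'M[R]_n :=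
  S *m diag_mx (\row_i d i) *m S^T.

Lemma eq_spectral_mx (R : rcfType) n (S : 'M[R]_n) d d' :
  d =1 d' -> spectral_mx S d = spectral_mx S d'.
Proof.
by move=> h; congr (_ *m diag_mx _ *m _); apply/rowP=> i; rewrite !mxE h.
Qed.

Lemma spectral_decompositionE (R : rcfType) n (A S : 'M[R]_n) lam :
  spectral_decomposition A S lam -> A = spectral_mx S (lam 0).
Proof.
case=> _ -> _ _; congr (_ *m diag_mx _ *m _).
by apply/rowP=> i; rewrite mxE.
Qed.

Lemma mulmx_diag_mxr (R : rcfType) m n (S : 'M[R]_(m, n)) (d : 'I_n -> R) i j :
  (S *m diag_mx (\row_i d i)) i j = S i j * d j.
Proof. by rewrite mul_mx_diag !mxE. Qed.

Lemma spectral_mxE (R : rcfType) n (S : 'M[R]_n) d i j :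
  spectral_mx S d i j = \sum_k S i k * d k * S j k.
Proof. by rewrite mxE; apply: eq_bigr => k _; rewrite mulmx_diag_mxr mxE. Qed.

Lemma spectral_mxM (R : rcfType) n (S : 'M[R]_n) d d' : S^T *m S = 1%:M ->
  spectral_mx S d *m spectral_mx S d' = spectral_mx S (fun i => d i * d' i).
Proof.
move=> hS; rewrite /spectral_mx !mulmxA -[_ *m S^T *m S]mulmxA hS mulmx1.
congr (_ *m _); rewrite -mulmxA mulmx_diag; congr (_ *m diag_mx _).
by apply/rowP=> i; rewrite !mxE.
Qed.

Lemma horner_spectral_mx (R : rcfType) n (S : 'M[R]_n.+1) d p : S^T *m S = 1%:M ->
  horner_mx (spectral_mx S d) p = spectral_mx S (fun i => p.[d i]).
Proof.
move=> hS; have [Su Si] : S \in unitmx /\ invmx S = S^T.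
  have [_ Su] := mulmx1_unit hS; split=> //.
  by rewrite -[LHS]mul1mx -hS mulmxK.
rewrite /spectral_mx -Si horner_mx_uconj // horner_mx_diag.
by congr (_ *m diag_mx _ *m _); apply/rowP=> i; rewrite !mxE.
Qed.

Lemma dotc_spectral (R : rcfType) n (S : 'M[R]_n) d (u v : 'cV[R]_n) :
  dotc u (spectral_mx S d *m v) =
    \sum_i d i * ((S^T *m u) i 0 * (S^T *m v) i 0).
Proof.
rewrite /dotc /spectral_mx -!mulmxA mulmxA -[u^T *m S]trmxK trmx_mul trmxK mxE.
by apply: eq_bigr => i _; rewrite mul_diag_mx !mxE; ring.
Qed.

Lemma spd_spectral_mx (R : rcfType) n (S : 'M[R]_n) d : S^T *m S = 1%:M ->
  (forall i, 0 < d i) -> spd (spectral_mx S d).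
Proof.
move=> hS d0; split=> [|x xn0].
  by rewrite /spectral_mx !trmx_mul trmxK tr_diag_mx mulmxA.
rewrite dotc_spectral lt_neqAle eq_sym.
have nn i : true -> 0 <= d i * ((S^T *m x) i 0 * (S^T *m x) i 0).
  by move=> _; rewrite -expr2 mulr_ge0 ?sqr_ge0 // ltW.
rewrite sumr_ge0 // andbT; apply: contra xn0; rewrite psumr_eq0 // => /allP h.
have /mulmx1C hS' := hS; rewrite -[x]mul1mx -hS' -mulmxA.
suff -> : S^T *m x = 0 by rewrite mulmx0.
apply/colP=> i; have := h i; rewrite mem_index_enum => /(_ isT).
by rewrite mulf_eq0 gt_eqF //= mulf_eq0 orbb => /eqP ->; rewrite mxE.
Qed.

Lemma spectral_mx_cst1 (R : rcfType) n (S : 'M[R]_n) : S^T *m S = 1%:M ->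
  spectral_mx S (fun=> 1) = 1%:M.
Proof.
move=> /mulmx1C <-; apply/matrixP=> a c; rewrite spectral_mxE mxE.
by apply: eq_bigr => i _; rewrite mxE mulr1.
Qed.

Lemma spd1 (R : rcfType) n : spd (1%:M : 'M[R]_n).
Proof.
have h1 : (1%:M : 'M[R]_n)^T *m 1%:M = 1%:M by rewrite trmx1 mulmx1.
rewrite -(spectral_mx_cst1 h1); exact: spd_spectral_mx.
Qed.

(** The squared energy norm of [spectral_mx S d *m e] is the sum of
    lam_i (d_i y_i)^2, where y holds the coordinates of e in the basis S, so a
    termwise comparison of the multipliers suffices. *)
Lemma normA_spectral_le (R : rcfType) n (A S : 'M[R]_n) lam d d' c
    (e : 'cV[R]_n) : spectral_decomposition A S lam -> 0 <= c ->
  (forall i, `|d i| <= c * `|d' i|) ->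
  normA A (spectral_mx S d *m e) <= c * normA A (spectral_mx S d' *m e).
Proof.
move=> hsd c0 hd; have AE := spectral_decompositionE hsd.
case: hsd => hS _ _ lam0.
have E f : dotc (spectral_mx S f *m e) (A *m (spectral_mx S f *m e)) =
    \sum_i lam 0 i * (f i * (S^T *m e) i 0) ^+ 2.
  have h i : (S^T *m (spectral_mx S f *m e)) i 0 = f i * (S^T *m e) i 0.
    by rewrite /spectral_mx -!mulmxA mulmxA hS mul1mx mul_diag_mx !mxE.
  by rewrite AE dotc_spectral; apply: eq_bigr => i _; rewrite h expr2.
rewrite -[c]ger0_norm // -sqrtr_sqr /normA !E -sqrtrM ?sqr_ge0 //.
rewrite ler_wsqrtr // mulr_sumr ler_sum // => i _.
rewrite [leRHS]mulrCA ler_wpM2l ?(ltW (lam0 i)) // !exprMn mulrA.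
rewrite ler_wpM2r ?sqr_ge0 //.
rewrite -exprMn -[d i ^+ 2]real_normK ?num_real // -[leRHS]real_normK ?num_real //.
by rewrite ler_sqr ?nnegrE ?normr_ge0 // normrM (ger0_norm c0).
Qed.

(** * The preconditioner and the deflated guess in the eigenbasis *)

Lemma scaled_spectral_precondE (R : rcfType) n (S : 'M[R]_n) lam (k : 'I_n) theta :
  S^T *m S = 1%:M ->
  scaled_spectral_precond S lam k theta =
    spectral_mx S (fun i => if (i < k)%N then theta / lam 0 i else 1).
Proof.
move=> /mulmx1C hS; apply/matrixP=> a c.
rewrite spectral_mxE /scaled_spectral_precond -hS mxE summxE.
rewrite (_ : (S *m S^T) a c = \sum_i S a i * S c i); last first.
  by rewrite mxE; apply: eq_bigr => i _; rewrite mxE.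
rewrite [X in _ + X]big_mkcond -big_split; apply: eq_bigr => i _ /=.
case: ifP => _; last by rewrite addr0 mulr1.
by rewrite !mxE big_ord1 !mxE; ring.
Qed.

(** The correction added to x0 is S_k Lambda_k^-1 S_k^T A e0, which is the
    orthogonal projection of e0 on the first k eigenvectors. *)
Lemma deflated_guess_error (R : rcfType) n (A S : 'M[R]_n) lam (k : 'I_n)
    (xs x0 : 'cV[R]_n) : spectral_decomposition A S lam ->
  xs - deflated_guess A S lam k (A *m xs) x0 =
    spectral_mx S (fun i => if (i < k)%N then 0 else 1) *m (xs - x0).
Proof.
move=> hsd; have AE := spectral_decompositionE hsd.
case: hsd => hS _ _ lam0.
have Dinv : invmx (lead_diag lam k) =
    diag_mx (\row_i (lam 0 (ord_first i))^-1).
  set D := diag_mx _.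
  have DD : D *m lead_diag lam k = 1%:M.
    rewrite mulmx_diag -diag_const_mx; congr diag_mx; apply/rowP=> i.
    by rewrite !mxE mulVf // gt_eqF.
  have [_ u] := mulmx1_unit DD.
  by rewrite -[LHS]mul1mx -DD mulmxK.
have LE : lead_vecs S k *m invmx (lead_diag lam k) *m (lead_vecs S k)^T =
    spectral_mx S (fun i => if (i < k)%N then (lam 0 i)^-1 else 0).
  apply/matrixP=> a c; rewrite spectral_mxE Dinv mxE.
  rewrite [RHS](bigID (fun i : 'I_n => (i < k)%N)) /=.
  rewrite [X in _ + X]big1 ?addr0; last first.
    by move=> i /negbTE->; rewrite mulr0 mul0r.
  rewrite (big_ord_narrow (ltnW (ltn_ord k))); apply: eq_bigr => i _.
  by rewrite mulmx_diag_mxr !mxE /= ltn_ord.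
rewrite /deflated_guess LE -mulmxBr {1}AE mulmxA spectral_mxM // opprD addrA.
rewrite -{1}[xs - x0]mul1mx -mulmxBl -(spectral_mx_cst1 hS); congr (_ *m _).
apply/matrixP=> a c; rewrite [LHS]mxE [X in _ + X]mxE !spectral_mxE -sumrB.
apply: eq_bigr => i _; case: ifP => _; last by rewrite mul0r !mulr0 mul0r subr0.
by rewrite mulVf ?gt_eqF // mulr0 mul0r subrr.
Qed.

Theorem theorem4p9 (R : rcfType) (n : nat) (A S : 'M[R]_n.+1)
    (lam : 'rV[R]_n.+1) (k : 'I_n.+1) (theta : R) (b x0 : 'cV[R]_n.+1)
    (hA : spd A) (hS : spectral_decomposition A S lam)
    (hk : (0 < k)%N) (htheta : 0 < theta) (l : nat) :
  let xstar := invmx A *m b in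
  let xPCG := pcg_iterate A (scaled_spectral_precond S lam k theta) b x0 in
  let xDef := cg_iterate A b (deflated_guess A S lam k b x0) in
  let alpha := Num.max `|lam 0 k - theta| `|theta - lam 0 ord_max| in
  normA A (xstar - xDef l.+1) <= normA A (xstar - xPCG l.+1) /\
  normA A (xstar - xPCG l.+1) <= alpha / theta * normA A (xstar - xDef l).
Proof.
move=> xs; set F := scaled_spectral_precond S lam k theta; move=> xPCG xDef alpha.
have [hO _ hmono lam0] := hS.
have AE := spectral_decompositionE hS.
have Au : A \in unitmx.
  rewrite unitmxE unitfE; apply/negP => /det0P[v vn0 vA].
  have := spd_dotc_gt0 hA (x := v^T); rewrite -(inj_eq trmx_inj) trmxK trmx0.
  by rewrite /dotc trmxK mulmxA vA mul0mx mxE ltxx => /(_ vn0).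
have bE : b = A *m xs by rewrite /xs mulKVmx.
have FE := scaled_spectral_precondE lam k theta hO; rewrite -/F in FE.
have hF : spd F.
  rewrite FE; apply: spd_spectral_mx => // i.
  by case: ifP => _; rewrite ?ltr01 ?divr_gt0.
pose mu (i : 'I_n.+1) := if (i < k)%N then theta else lam 0 i.
have FAE : F *m A = spectral_mx S mu.
  rewrite FE AE spectral_mxM //; apply: eq_spectral_mx => i.
  by rewrite /mu; case: ifP => _; rewrite ?mul1r // divfK // gt_eqF.
(* w is the mask that deflation puts on the initial error. *)
pose w (i : 'I_n.+1) : R := if (i < k)%N then 0 else 1.
have optF := pcg_iterate_optimal xs x0 _ hA hF.
have optD m :=
  pcg_iterate_optimal xs (deflated_guess A S lam k b x0) m hA (spd1 _ _).
rewrite -bE in optF; rewrite -bE in optD.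
have defE P : horner_mx (1%:M *m A) P *m (xs - deflated_guess A S lam k b x0) =
    spectral_mx S (fun i => P.[lam 0 i] * w i) *m (xs - x0).
  rewrite bE (deflated_guess_error _ _ _ hS) mul1mx AE horner_spectral_mx //.
  by rewrite mulmxA spectral_mxM.
have pcgE P : horner_mx (F *m A) P *m (xs - x0) =
    spectral_mx S (fun i => P.[mu i]) *m (xs - x0).
  by rewrite FAE horner_spectral_mx.
split.
- have [P [sP P0 eP _]] := optF l.+1; have [_ [_ _ _ opt]] := optD l.+1.
  apply: le_trans (opt P sP P0) _; rewrite -/F in eP; rewrite /xPCG eP defE pcgE.
  rewrite -[leRHS]mul1r; apply: (normA_spectral_le _ hS) => // i.
  by rewrite /w /mu mul1r; case: ifP => _; rewrite ?mulr0 ?normr0 ?mulr1.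
- have [P [sP P0 eP _]] := optD l; have [_ [_ _ _ opt]] := optF l.+1.
  pose Q := P * (1 - theta^-1 *: 'X).
  have Q0 : Q.[0] = 1 by rewrite !hornerE P0 mul1r; ring.
  have sQ : (size Q <= l.+2)%N.
    have s1 : (size (1 - theta^-1 *: 'X : {poly R})%R <= 2)%N.
      rewrite (leq_trans (size_polyD _ _)) // geq_max size_poly1 size_polyN.
      by rewrite (leq_trans (size_scale_leq _ _)) // size_polyX.
    apply: leq_trans (size_polyMleq _ _) _.
    by have := leq_add sP s1; rewrite addnS addn1; case: (_ + _)%N.
  apply: le_trans (opt Q sQ Q0) _.
  rewrite /xDef /cg_iterate eP defE pcgE.
  have a0 : 0 <= alpha by rewrite le_max normr_ge0.
  apply: (normA_spectral_le _ hS) => [|i]; first by rewrite divr_ge0 // ltW.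
  rewrite /w /mu !hornerE; case: ltnP => ki.
    by rewrite mulVf ?gt_eqF // subrr !mulr0 normr0 mulr0.
  rewrite mulr1 normrM mulrC ler_wpM2r //.
  have -> : 1 - theta^-1 * lam 0 i = (theta - lam 0 i) / theta.
    by field; rewrite gt_eqF.
  rewrite normrM normfV (gtr0_norm htheta) ler_pM2r ?invr_gt0 //.
  have h1 := hmono _ _ ki.
  have h2 : lam 0 ord_max <= lam 0 i by rewrite hmono // leq_ord.
  rewrite ler_norml; apply/andP; split.
    rewrite lerNl opprB (le_trans (lerB h1 (lexx theta))) //.
    rewrite (le_trans (ler_norm _)) //.
    by rewrite le_max lexx.
  rewrite (le_trans (lerB (lexx theta) h2)) // (le_trans (ler_norm _)) //.
  by rewrite le_max lexx orbT.
Qed.
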